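(* Let $\mathcal{X}$ be an infinite-dimensional real Banach space and let $\kappa,\tau>0$. Then $$\sqrt{\kappa^2+\tau^2}\le \mathcal{T}_2(\kappa,\tau,\mathcal{X})\le \kappa+\tau.$$
   Context: $S_{\mathcal{X}}$ denotes the unit sphere of $\mathcal{X}$. For $\kappa,\tau>0$, $$\mathcal{T}_2(\kappa,\tau,\mathcal{X})=\sup_{x_1,x_2\in S_{\mathcal{X}}}\big(\|\kappa x_1+\tau x_2\|\,\|\tau x_1-\kappa x_2\|\big)^{1/2}.$$ *)

(* Defs.v *)
From mathcomp Require Import all_boot all_order all_algebra.
From mathcomp Require Import all_classical all_reals all_analysis.
Set Implicit Arguments.
Unset Strict Implicit.
Unset Printing Implicit Defensive.
Import Order.TTheory GRing.Theory Num.Theory.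
Import numFieldNormedType.Exports.
Local Open Scope classical_set_scope.
Local Open Scope ring_scope.

Definition finite_dimensional (K : fieldType) (V : lmodType K) : Prop :=
  exists (n : nat) (e : 'I_n -> V),
    forall x : V, exists c : 'I_n -> K, x = \sum_(i < n) c i *: e i.

Definition infinite_dimensional (K : fieldType) (V : lmodType K) : Prop :=
  ~ finite_dimensional V.

Definition unit_sphere (R : realType) (X : normedModType R) : set X :=
  [set x | `|x| = 1].

(* The supremum is taken in R, where sup is 0 on empty or unbounded sets.
   Neither occurs here: the sphere is nonempty as soon as X <> 0, and all the
   values are at most `|kappa| + `|tau|. *)
Definition T2 (R : realType) (kappa tau : R) (X : normedModType R) : R :=
  sup [set t | exists x1 x2 : X,
    [/\ unit_sphere x1, unit_sphere x2 &
        t = Num.sqrt (`|kappa *: x1 + tau *: x2| * `|tau *: x1 - kappa *: x2|)]].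

(* Main.v *)
Require Import Defs.
From mathcomp Require Import all_boot all_order all_algebra.
From mathcomp Require Import all_classical all_reals all_analysis.
From mathcomp Require Import ring lra.
Import Order.TTheory GRing.Theory Num.Theory.
Import numFieldNormedType.Exports.
Local Open Scope ring_scope.

(** The upper bound is the triangle inequality.  The lower bound already holds
    in every space of dimension at least two, by an area argument.  In the
    plane spanned by two independent vectors, let [M] be the supremum of the
    areas [|det(x, y)|] over unit vectors [x], [y] (the supremum which an
    Auerbach basis attains).  By homogeneity,
    [|det(u, v)| <= M * |u| * |v|] for all [u], [v] in the plane.  The pair
    [u = kappa x + tau y], [v = tau x - kappa y] is obtained from [(x, y)] by a
    matrix of determinant [-(kappa^2 + tau^2)], hence
    [(kappa^2 + tau^2) |det(x, y)| <= M * |u| * |v| <= M * T2^2].  Taking the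
    supremum over [x], [y] turns the left side into [(kappa^2 + tau^2) M], and
    [M > 0] cancels.  The only analytic point is that [M] is finite, which
    follows from the distance of a vector to a line through the origin being
    attained ([coord_bounded]). *)

Definition independent2 {K : fieldType} {V : lmodType K} (a b : V) : Prop :=
  forall s t : K, s *: a + t *: b = 0 -> s = 0 /\ t = 0.

Lemma independent2_neq0 {K : fieldType} {V : lmodType K} {a b : V} :
  independent2 a b -> a != 0 /\ b != 0.
Proof.
move=> ab; split; apply/eqP => v0.
- have [|/eqP] := ab 1 0; last by rewrite oner_eq0.
  by rewrite v0 scaler0 scale0r addr0.
- have [|_ /eqP] := ab 0 1; last by rewrite oner_eq0.
  by rewrite v0 scaler0 scale0r addr0.
Qed.

Lemma infinite_dimensional_independent2 {K : fieldType} {V : lmodType K} :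
  infinite_dimensional V -> exists a b : V, independent2 a b.
Proof.
move=> hV.
have [a a0] : exists a : V, a != 0.
  apply: contrapT => /forallNP h; apply: hV.
  exists 0, (fun=> 0) => x; exists (fun=> 0); rewrite big_ord0.
  by have /negP := h x; rewrite negbK => /eqP.
have [b hb] : exists b : V, forall c : K, b <> c *: a.
  apply: contrapT => /forallNP h; apply: hV.
  exists 1, (fun=> a) => x.
  have /existsNP[c /contrapT xE] := h x.
  by exists (fun=> c); rewrite big_ord1.
exists a, b => s t st0.
have t0 : t = 0.
  apply: contrapT => /eqP t0; apply: (hb (- (t^-1 * s))).
  have := congr1 (fun v => t^-1 *: v) st0.
  rewrite scaler0 scalerDr !scalerA mulVf // scale1r addrC => /eqP.
  by rewrite addr_eq0 scaleNr => /eqP.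
split=> //; move: st0; rewrite t0 scale0r addr0 => /eqP.
by rewrite scaler_eq0 (negbTE a0) orbF => /eqP.
Qed.

Section Plane.
Context {R : realType} {X : normedModType R}.
Implicit Types (a b : X) (s t : R).
Local Open Scope classical_set_scope.

(** The constant is the distance of [a] to the line [R b], a minimum over a
    compact interval since [|a + t b|] exceeds its value at [t = 0] once
    [|t b| > 2 |a|]; it is positive because [a] is off that line. *)
Lemma coord_bounded {a b} : independent2 a b ->
  exists2 d : R, 0 < d & forall s t, d * `|s| <= `|s *: a + t *: b|.
Proof.
move=> ab.
have b0 : 0 < `|b| by rewrite normr_gt0 (independent2_neq0 ab).2.
pose f t := `|a + t *: b|.
pose k := 2 * `|a| / `|b|.
have k0 : 0 <= k by rewrite divr_ge0 // mulr_ge0.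
have fc : continuous f.
  move=> t; apply: cvg_norm; apply: cvgD; first exact: cvg_cst.
  by apply: cvgZ; [exact: cvg_id | exact: cvg_cst].
have [|c _ cmin] := @EVT_min R f (- k) k _ (continuous_subspaceT fc).
  by lra.
have fmin t : f c <= f t.
  have [tk|tk] := boolP (t \in `[- k, k]%R); first exact: cmin.
  have f0 : f c <= `|a|.
    have := cmin 0; rewrite /f scale0r addr0; apply.
    by rewrite in_itv /=; lra.
  have tk' : k < `|t|.
    by rewrite ltNge; apply: contra tk; rewrite in_itv /= ler_norml.
  move: tk'; rewrite /k ltr_pdivrMr // -normrZ => tb.
  have := lerB_normD (t *: b) a; rewrite addrC -/(f t).
  by rewrite [t *: b + a]addrC -/(f t); lra.
exists (f c) => [|s t].
  rewrite normr_gt0; apply/eqP => fc0.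
  have [|/eqP] := ab 1 c; first by rewrite scale1r.
  by rewrite oner_eq0.
have [->|s0] := eqVneq s 0; first by rewrite normr0 mulr0.
have -> : s *: a + t *: b = s *: (a + (s^-1 * t) *: b).
  by rewrite scalerDr scalerA mulrA mulfV // mul1r.
by rewrite normrZ mulrC ler_wpM2l // fmin.
Qed.

Definition sphere_areas a b : set R :=
  [set r | exists s t s' t' : R,
    [/\ `|s *: a + t *: b| = 1, `|s' *: a + t' *: b| = 1 &
        r = `|s * t' - s' * t|]].

Lemma sphere_areas_pos {a b} : independent2 a b ->
  exists2 r, sphere_areas a b r & 0 < r.
Proof.
move=> ab; have [a0 b0] := independent2_neq0 ab.
exists (`|(`|a|^-1 * `|b|^-1 - 0 * 0)|).
  exists `|a|^-1, 0, 0, `|b|^-1; rewrite !scale0r addr0 add0r.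
  by split=> //; rewrite normrZ normfV normr_id mulVf // normr_eq0.
by rewrite mulr0 subr0 normr_gt0 mulf_neq0 // invr_neq0 // normr_eq0.
Qed.

(** With [x = s a + t b] and [x' = s' a + t' b] on the sphere,
    [s x' - s' x = (s t' - s' t) b], so that the area is at most
    [(|s| + |s'|) / |b|], and only the coordinate along [a] needs a bound. *)
Lemma sphere_areas_ubound {a b} : independent2 a b -> has_ubound (sphere_areas a b).
Proof.
move=> ab.
have [d d0 hd] := coord_bounded ab.
have b0 : 0 < `|b| by rewrite normr_gt0 (independent2_neq0 ab).2.
exists (2 / d / `|b|) => _ [s [t [s' [t' [x1 x'1 ->]]]]].
have ds : `|s| <= d^-1 by rewrite -[d^-1]mul1r ler_pdivlMr // mulrC -x1.
have ds' : `|s'| <= d^-1 by rewrite -[d^-1]mul1r ler_pdivlMr // mulrC -x'1.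
rewrite ler_pdivlMr // -normrZ.
have -> : (s * t' - s' * t) *: b =
    s *: (s' *: a + t' *: b) - s' *: (s *: a + t *: b).
  by rewrite !scalerDr !scalerA opprD addrACA [s' * s]mulrC subrr add0r scalerBl.
apply: le_trans (ler_normB _ _) _.
by rewrite !normrZ x1 x'1 !mulr1; lra.
Qed.

Lemma area_le {a b} : independent2 a b -> forall s t s' t',
  `|s * t' - s' * t| <=
    sup (sphere_areas a b) * (`|s *: a + t *: b| * `|s' *: a + t' *: b|).
Proof.
move=> ab s t s' t'.
set x := s *: a + t *: b; set x' := s' *: a + t' *: b.
have [x0|x0] := eqVneq x 0.
  by have [-> ->] := ab _ _ x0; rewrite mul0r mulr0 subrr normr0 x0 normr0 mul0r mulr0.
have [x'0|x'0] := eqVneq x' 0.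
  by have [-> ->] := ab _ _ x'0; rewrite mul0r mulr0 subrr normr0 x'0 normr0 !mulr0.
have xp : 0 < `|x| by rewrite normr_gt0.
have x'p : 0 < `|x'| by rewrite normr_gt0.
rewrite -ler_pdivrMr ?mulr_gt0 //.
apply: (ub_le_sup (sphere_areas_ubound ab)).
exists (`|x|^-1 * s), (`|x|^-1 * t), (`|x'|^-1 * s'), (`|x'|^-1 * t').
rewrite -!scalerA -!scalerDr -/x -/x' !normrZ !normfV !normr_id.
rewrite !mulVf ?gt_eqF //; split=> //.
have -> : `|x|^-1 * s * (`|x'|^-1 * t') - `|x'|^-1 * s' * (`|x|^-1 * t) =
    (s * t' - s' * t) / (`|x| * `|x'|).
  by field; rewrite !gt_eqF.
by rewrite normrM normfV (ger0_norm (mulr_ge0 (ltW xp) (ltW x'p))).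
Qed.

Lemma T2_value_le {kappa tau : R} {x y : X} : 0 < kappa -> 0 < tau ->
  `|x| = 1 -> `|y| = 1 ->
  Num.sqrt (`|kappa *: x + tau *: y| * `|tau *: x - kappa *: y|) <= kappa + tau.
Proof.
move=> k0 t0 x1 y1.
have kt0 : 0 <= kappa + tau by rewrite addr_ge0 ?ltW.
rewrite -[leRHS]ger0_norm // -sqrtr_sqr ler_sqrt ?exprn_ge0 // expr2.
apply: ler_pM => //.
  by apply: le_trans (ler_normD _ _) _; rewrite !normrZ x1 y1 !mulr1 !gtr0_norm.
apply: le_trans (ler_normB _ _) _.
by rewrite !normrZ x1 y1 !mulr1 !gtr0_norm // addrC.
Qed.

Lemma T2_ge {kappa tau : R} {x y : X} : 0 < kappa -> 0 < tau ->
  `|x| = 1 -> `|y| = 1 ->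
  Num.sqrt (`|kappa *: x + tau *: y| * `|tau *: x - kappa *: y|)
    <= T2 kappa tau X.
Proof.
move=> k0 t0 x1 y1; apply: ub_le_sup; last by exists x, y.
by exists (kappa + tau) => _ [u [v [u1 v1 ->]]]; exact: T2_value_le.
Qed.

Lemma T2_sqr_ge {kappa tau : R} {x y : X} : 0 < kappa -> 0 < tau ->
  `|x| = 1 -> `|y| = 1 ->
  `|kappa *: x + tau *: y| * `|tau *: x - kappa *: y| <= T2 kappa tau X ^+ 2.
Proof.
move=> k0 t0 x1 y1.
have pT := T2_ge k0 t0 x1 y1.
rewrite -[leLHS]sqr_sqrtr ?mulr_ge0 // lerXn2r ?nnegrE ?sqrtr_ge0 //.
exact: le_trans (sqrtr_ge0 _) pT.
Qed.

(** Multiplication by the matrix with rows [(kappa, tau)], [(tau, -kappa)]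
    scales areas by [kappa^2 + tau^2], while [area_le] bounds the area of the
    image pair by the product of norms that [T2] controls. *)
Lemma area_scaling_le {kappa tau : R} {a b r} : 0 < kappa -> 0 < tau ->
  independent2 a b -> sphere_areas a b r ->
  (kappa ^+ 2 + tau ^+ 2) * r <= sup (sphere_areas a b) * T2 kappa tau X ^+ 2.
Proof.
move=> k0 t0 ab rS.
have M0 : 0 <= sup (sphere_areas a b).
  apply: le_trans (ub_le_sup (sphere_areas_ubound ab) rS).
  by case: rS => [s [t [s' [t' [_ _ ->]]]]].
case: rS => [s [t [s' [t' [x1 y1 ->]]]]].
apply: le_trans (ler_wpM2l M0 (T2_sqr_ge k0 t0 x1 y1)).
have -> : kappa *: (s *: a + t *: b) + tau *: (s' *: a + t' *: b) =
    (kappa * s + tau * s') *: a + (kappa * t + tau * t') *: b.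
  by rewrite !scalerDr !scalerA !scalerDl addrACA.
have -> : tau *: (s *: a + t *: b) - kappa *: (s' *: a + t' *: b) =
    (tau * s - kappa * s') *: a + (tau * t - kappa * t') *: b.
  by rewrite !scalerDr !scalerA !scalerBl opprD addrACA.
apply: le_trans (area_le ab _ _ _ _).
rewrite -[kappa ^+ 2 + tau ^+ 2]ger0_norm ?addr_ge0 ?sqr_ge0 //.
rewrite -normrM -normrN le_eqVlt; apply/orP; left; apply/eqP; congr `|_|.
by ring.
Qed.

End Plane.

Theorem proposition3 (R : realType) (X : completeNormedModType R)
    (hX : infinite_dimensional X) (kappa tau : R)
    (hkappa : 0 < kappa) (htau : 0 < tau) :
  Num.sqrt (kappa ^+ 2 + tau ^+ 2) <= T2 kappa tau X /\
  T2 kappa tau X <= kappa + tau.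
Proof.
have [a [b ab]] := infinite_dimensional_independent2 hX.
have [r rS r0] := sphere_areas_pos ab.
have kt0 : 0 < kappa ^+ 2 + tau ^+ 2 by rewrite addr_gt0 ?exprn_gt0.
have M0 : 0 < sup (sphere_areas a b).
  exact: lt_le_trans r0 (ub_le_sup (sphere_areas_ubound ab) rS).
have [s [t [_ [_ [x1 _ _]]]]] := rS.
set x := s *: a + t *: b in x1.
split; last first.
  apply: ge_sup; first by eexists; exists x, x; split.
  by move=> _ [u [v [u1 v1 ->]]]; exact: T2_value_le.
have T0 := le_trans (sqrtr_ge0 _) (T2_ge hkappa htau x1 x1).
rewrite -[leRHS]ger0_norm // -sqrtr_sqr ler_sqrt ?sqr_ge0 //.
rewrite -(ler_pM2r M0) [leRHS]mulrC -ler_pdivlMl //.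
apply: ge_sup; first by exists r.
by move=> q qS; rewrite ler_pdivlMl // area_scaling_le.
Qed.
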